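(* Let $\mu\in\mathcal M^+(\mathbb R)\setminus\{0\}$ satisfy $\|\mu\|_1\le 1$. Suppose that $c,c'\in I$ both satisfy the system (written for $c$) $$c_t(x,t)=H(c,x,t)^2\int_{z\ne x}K'''(c(x,t)-c(z,t))\,d\mu(z),\qquad c(x,0)=x,\qquad (x,t)\in\mathbb R\times(0,\infty).$$ Then $c=c'$.
   Context: $\mathbb R^+=[0,\infty)$. $\alpha>0$ is a fixed constant and $K(x)=\frac1{4\alpha^2}(\alpha+|x|)e^{-|x|/\alpha}$; $K'''$ is its classical third derivative, defined on $\mathbb R\setminus\{0\}$. $\mathcal M^+(\mathbb R)$ is the set of finite positive Borel measures on $\mathbb R$ and $\|\cdot\|_1$ is the total variation norm. $I=I_{\mathbb R}$ is the set of locally bounded functions $c:\mathbb R\times\mathbb R^+\to\mathbb R$ such that $c(\cdot,t)$ is Borel measurable for all $t\in\mathbb R^+$, $c(x,\cdot)$ is $C^1$ for all $x\in\mathbb R$, and $c(x,t)<c(y,t)$ for all $t\in\mathbb R^+$ and all $x<y$. $H(c,x,t)=\int_{-\infty}^\infty K(c(x,t)-c(z,t))\,d\mu(z)$. (The prime in $c'$ does not denote a derivative.) *)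

(* Defs.v *)
From HB Require Import structures.
From mathcomp Require Import all_boot all_order all_algebra.
From mathcomp Require Import all_classical all_reals all_analysis.
Import Order.TTheory GRing.Theory Num.Theory.
Import numFieldNormedType.Exports.

Set Implicit Arguments.
Unset Strict Implicit.
Unset Printing Implicit Defensive.

Local Open Scope classical_set_scope.
Local Open Scope ring_scope.

Definition Kfun (R : realType) (alpha : R) (x : R) : R :=
  (4 * alpha ^+ 2)^-1 * (alpha + `|x|) * expR (- `|x| / alpha).

(* The value at 0, where the third derivative does not exist, is a
   meaningless default; it is never used below, since [velocity] integrates
   over [z != x] and the maps [x |-> c x t] are injective. *)
Definition K3 (R : realType) (alpha : R) : R -> R :=
  ((Kfun alpha)^`(3))%classic.

Definition tv_norm (d : measure_display) (T : measurableType d) (R : realType)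
    (nu : set T -> \bar R) : \bar R :=
  ereal_sup [set (\sum_(0 <= n <oo) `|nu (E n)|)%E | E in
    [set E : nat -> set T | [/\ forall n, measurable (E n),
                                trivIset setT E &
                                \bigcup_n E n = setT]]].

(* Functions of time are total on [R], but only their values at nonnegative
   times matter: [f] is C^1 on [0, +oo[, the derivative [g] being one-sided
   at 0. *)
Definition C1_nonneg (R : realType) (f : R -> R) : Prop :=
  exists g : R -> R,
    {within `[0, +oo[, continuous g} /\
    forall t : R, 0 <= t ->
      (f s - f t) / (s - t) @[s --> within `[0, +oo[ (t^')] --> g t.

Definition class_I (R : realType) (c : R -> R -> R) : Prop :=
  [/\ [locally [bounded c p.1 p.2 | p in [set p : R * R | 0 <= p.2]]],
      forall t : R, 0 <= t ->
        measurable_fun setT (fun x : measurableTypeR R => c x t),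
      forall x : R, C1_nonneg (c x) &
      forall t : R, 0 <= t -> forall x y : R, x < y -> c x t < c y t].

Section system.
Context (R : realType) (alpha : R).
Context (mu : {finite_measure set (measurableTypeR R) -> \bar R}).
Implicit Types c : R -> R -> R.

Definition Hfun c (x t : R) : R :=
  \int[mu]_z Kfun alpha (c x t - c z t).

Definition velocity c (x t : R) : R :=
  Hfun c x t ^+ 2 *
  \int[mu]_(z in [set z | z != x]) K3 alpha (c x t - c z t).

Definition solves_system c : Prop :=
  (forall x t : R, 0 < t -> (c x)^`()%classic t = velocity c x t) /\
  (forall x : R, c x 0 = x).

End system.

(* Main.v *)
Require Import Defs.
From mathcomp Require Import all_boot all_order all_algebra.
From mathcomp Require Import all_classical all_reals all_analysis.
From mathcomp Require Import measurable_realfun ring lra.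
Import Order.TTheory GRing.Theory Num.Theory.
Import numFieldNormedType.Exports.

(* Solutions are order preserving in x, so c(x,t) - c(z,t) and
   c'(x,t) - c'(z,t) have the same sign. Hence the jump of K''' at 0 is never
   crossed, and the velocity field is bounded (by M) and L-Lipschitz for the
   sup norm in x. The bound gives |c - c'|(x,t) <= 2Mt <= (M/L) exp(2Lt); then
   integrating the Lipschitz estimate against the weight exp(2Lt) halves the
   constant at each step, so |c - c'|(x,t) <= 2^-n (M/L) exp(2Lt) for all n. *)

Local Open Scope classical_set_scope.
Local Open Scope ring_scope.

(** * Bounds for affine functions times a decaying exponential *)

Section affine_exponential.
Context {R : realType}.
Implicit Types a b k u v x : R.

Lemma expRN_le1 u : 0 <= u -> 0 < expR (- u) <= 1.
Proof. by move=> u0; rewrite expR_gt0 -[leRHS]expR0 ler_expR; lra. Qed.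

Lemma mul_expRN_le1 u : 0 <= u -> 0 <= u * expR (- u) <= 1.
Proof.
move=> u0; have /andP[e0 _] := expRN_le1 u u0.
have := expR_ge1Dx u; have : expR u * expR (- u) = 1 by rewrite -expRD subrr expR0.
set e := expR (- u) in e0 *; set d := expR u; nra.
Qed.

(** Factor out [expR (- u)] and use [1 + (u - v) <= expR (u - v) <= 1]. *)
Lemma expRN_diff_bounds u v : u <= v ->
  0 <= expR (- u) - expR (- v) <= expR (- u) * (v - u).
Proof.
move=> uv.
have -> : expR (- v) = expR (- u) * expR (u - v) by rewrite -expRD; congr expR; ring.
have := expR_ge1Dx (u - v); have := expR_gt0 (- u).
have : expR (u - v) <= 1 by rewrite -[leRHS]expR0 ler_expR; lra.
set e := expR (- u); set d := expR (u - v); nra.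
Qed.

(** With [u] equal to |x|/alpha, both K and, away from 0 and up to sign, K''' have this form, so one
    set of estimates serves both kernels. *)
Definition affexp a b u : R := (a + b * u) * expR (- u).

Lemma affexp_bounded a b u : 0 <= u -> `|affexp a b u| <= `|a| + `|b|.
Proof.
move=> u0; have /andP[/ltW e0 e1] := expRN_le1 u u0.
have /andP[ue0 ue1] := mul_expRN_le1 u u0.
rewrite /affexp mulrDl -mulrA (le_trans (ler_normD _ _))// !normrM.
by rewrite (ger0_norm u0) (ger0_norm e0) lerD// ler_piMr.
Qed.

Lemma affexp_lipschitz a b u v : 0 <= u -> 0 <= v ->
  `|affexp a b u - affexp a b v| <= (`|a| + 2 * `|b|) * `|u - v|.
Proof.
wlog uv : u v / u <= v => [H u0 v0|u0 v0].
  have [uv|/ltW vu] := leP u v; first exact: H.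
  by rewrite distrC (distrC u); exact: H.
(* The first term is at most |a + bu| exp(-u) (v - u), which [affexp_bounded] controls by (|a| +
   |b|)(v - u); the second adds another |b|(v - u). *)
have -> : affexp a b u - affexp a b v =
    (a + b * u) * (expR (- u) - expR (- v)) + b * (u - v) * expR (- v).
  by rewrite /affexp; ring.
have /andP[d0 d1] := expRN_diff_bounds u v uv.
have /andP[/ltW e0 e1] := expRN_le1 v v0.
rewrite (le_trans (ler_normD _ _))// (normrM (a + b * u)) (normrM (b * _)) (normrM b).
rewrite (ger0_norm d0) (ger0_norm e0).
have vu0 : 0 <= v - u by rewrite subr_ge0.
have H : `|a + b * u| * (expR (- u) - expR (- v)) <= (`|a| + `|b|) * `|u - v|.
  have h := affexp_bounded a b u u0.
  rewrite distrC (ger0_norm vu0); apply: le_trans (ler_wpM2r vu0 h).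
  rewrite /affexp normrM (@ger0_norm _ (expR _)) ?expR_ge0// -mulrA.
  exact: ler_wpM2l.
have H' : `|b| * `|u - v| * expR (- v) <= `|b| * `|u - v| by rewrite ler_piMr ?mulr_ge0.
lra.
Qed.

Lemma measurable_affexp a b : measurable_fun setT (affexp a b).
Proof.
apply: measurable_funM.
  by apply: measurable_funD => //; apply: measurable_funM.
by apply: measurableT_comp => //; exact: measurableT_comp.
Qed.

End affine_exponential.

(** * Differentiating an affine function times an exponential *)

Section kernel_derivatives.
Context {R : realType}.
Implicit Types (a b k s x : R) (F : R -> R).

(** The sign [s] selects an open half-line, on which a formula for [F] determines its derivative.
    The result has the same shape as the hypothesis, so the lemma can be iterated. *)
Lemma derive1_affine_expR s a b k F :
  (forall y, 0 < s * y -> F y = (a + b * y) * expR (k * y)) ->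
  forall x, 0 < s * x ->
    F^`()%classic x = ((b + k * a) + (k * b) * x) * expR (k * x).
Proof.
move=> FE x sx; rewrite derive1E.
have sx_near : \forall y \near x, 0 < s * y.
  have : s * y @[y --> x] --> s * x by apply: cvgMl_tmp; exact: cvg_id.
  by move/cvgr_gt; apply.
have -> : 'D_1 F x = 'D_1 (fun y => (a + b * y) * expR (k * y)) x.
  by apply: near_eq_derive; near=> y; apply: FE; near: y.
rewrite derive_val /=.
rewrite /GRing.scale /=; ring.
Unshelve. all: by end_near. Qed.
End kernel_derivatives.

(** * Regularity in time and a mean value inequality *)

Lemma C1_nonneg_incr (R : realType) (f : R -> R) : C1_nonneg f ->
  exists g : R -> R, forall t, 0 <= t -> forall e, 0 < e ->
    exists2 d, 0 < d & forall u, 0 <= u -> `|u - t| < d ->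
      `|f u - f t - g t * (u - t)| <= e * `|u - t|.
Proof.
move=> [g [_ fg]]; exists g => t t0 e e0.
have /cvgrPdist_lt/(_ _ e0) := fg t t0.
rewrite /= !near_withinE => /nbhs_ballP[d /= d0 dP].
(* Clearing the denominator gives a first-order expansion that also makes sense at [u = t], where
   the punctured limit says nothing. *)
exists d => // u u0 ud; have [->|ut] := eqVneq u t.
  by rewrite !subrr mulr0 subrr normr0 mulr0.
have := dP u; rewrite /ball/= distrC => /(_ ud ut).
rewrite /= in_itv/= u0 => /(_ isT) H.
have ut0 : u - t != 0 by rewrite subr_eq0.
have -> : f u - f t - g t * (u - t) = - (g t - (f u - f t) / (u - t)) * (u - t).
  by field.
by rewrite normrM normrN ler_wpM2r// ltW.
Qed.

(** Near [t] the expansion with error 1 gives |f u - f t| <= (|g t| + 1)|u - t|. Continuity down to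
    time 0 is what the mean value theorem on [0, t] asks for. *)
Lemma C1_nonneg_continuous (R : realType) (f : R -> R) :
  C1_nonneg f -> {within `[0, +oo[, continuous f}.
Proof.
move=> /C1_nonneg_incr[g fg]; apply/subspace_continuousP => t.
rewrite /= in_itv/= andbT => t0.
have [d d0 dP] := fg t t0 1 ltr01.
apply/cvgrPdist_lt => e e0; rewrite near_withinE; apply/nbhs_ballP.
have g1 : 0 < `|g t| + 1 by rewrite ltr_wpDl.
exists (Num.min d (e / (`|g t| + 1))); first by rewrite /= lt_min d0 divr_gt0.
move=> u; rewrite /ball/= lt_min distrC => /andP[ud ue].
rewrite in_itv/= andbT => u0.
rewrite distrC; have := dP u u0 ud; rewrite mul1r => H.
rewrite ltr_pdivlMr// in ue; apply: le_lt_trans ue.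
have -> : f u - f t = f u - f t - g t * (u - t) + g t * (u - t) by ring.
by rewrite (le_trans (ler_normD _ _))// normrM; lra.
Qed.

Lemma C1_nonneg_derivable (R : realType) (f : R -> R) (t : R) :
  C1_nonneg f -> 0 < t -> derivable f t 1.
Proof.
move=> /C1_nonneg_incr[g fg] t0; apply/cvg_ex; exists (g t).
apply/cvgrPdist_le => e e0; have [d d0 dP] := fg t (ltW t0) e e0.
rewrite near_withinE; apply/nbhs_ballP.
(* Increments shorter than [t] stay among nonnegative times, so the expansion relative to [0, oo[
   yields a two-sided derivative. *)
exists (Num.min d t); first by rewrite /= lt_min d0 t0.
move=> h; rewrite /ball/= sub0r normrN lt_min => /andP[hd ht] h0.
have := dP (h *: 1 + t); rewrite /GRing.scale/= mulr1 addrK => H.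
have h1 : 0 <= h + t by move: ht; rewrite ltr_norml; lra.
have := H h1 hd; rewrite -ler_pdivrMr ?normr_gt0//.
rewrite -normfV -normrM distrC; apply: le_trans.
by rewrite le_eqVlt; apply/orP; left; apply/eqP; congr (`|_|); field.
Qed.

(* By the mean value theorem applied to [g - f] and [g + f]. *)
Lemma norm_increment_le (R : realType) (f df g dg : R -> R) (t : R) :
  0 <= t ->
  (forall s, s \in `]0, t[ -> is_derive (s : R) (1 : R) f (df s)) ->
  (forall s, is_derive (s : R) (1 : R) g (dg s)) ->
  {within `[0, t], continuous f} ->
  (forall s, s \in `]0, t[ -> `|df s| <= dg s) ->
  `|f t - f 0| <= g t - g 0.
Proof.
rewrite le_eqVlt => /predU1P[<- *|t0 fd gd fc fg].
  by rewrite !subrr normr0.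
have gc : {within `[0, t], continuous g}.
  by apply: derivable_within_continuous => s _; have [] := gd s.
have [x xt] := @MVT R (g - f) (dg - df) 0 t t0
  (fun s st => is_deriveB (gd s) (fd s st)) (within_continuousB gc fc).
have [y yt] := @MVT R (g + f) (dg + df) 0 t t0
  (fun s st => is_deriveD (gd s) (fd s st)) (within_continuousD gc fc).
have := fg x xt; have := fg y yt.
rewrite !fctE !ler_norml subr0 => /andP[a1 a2] /andP[a3 a4] e1 e2.
nra.
Qed.

(** * Closed forms of K and K''' *)

Section kernels.
Context {R : realType} (alpha : R) (alpha_gt0 : 0 < alpha).
Let alpha_neq0 : alpha != 0. Proof. by rewrite gt_eqF. Qed.

Lemma KfunE x :
  Kfun alpha x = affexp (4 * alpha)^-1 (4 * alpha)^-1 (`|x| / alpha).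
Proof. by rewrite /Kfun /affexp mulNr; congr (_ * _); field. Qed.

(** On the half-line of the points with the sign of [x], K is affine times an exponential of rate
    -s/alpha, and three applications of [derive1_affine_expR] give the third derivative. *)
Lemma K3E x : x != 0 ->
  K3 alpha x =
  Num.sg x * affexp (2 * alpha ^+ 4)^-1 (- (4 * alpha ^+ 4)^-1) (`|x| / alpha).
Proof.
move=> x0; set s := Num.sg x.
have s2 : s * s = 1 by rewrite -expr2 sqr_sg x0.
have sx : 0 < s * x by rewrite -normrEsg normr_gt0.
have normE y : 0 < s * y -> `|y| = s * y.
  move=> sy; have := ger0_norm (ltW sy).
  by rewrite normrM normr_sg x0 mul1r.
pose q := (4 * alpha ^+ 2)^-1.
have K0 y : 0 < s * y ->
    Kfun alpha y = (q * alpha + q * s * y) * expR (- s / alpha * y).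
  move=> sy; rewrite /Kfun normE// -/q; congr (_ * expR _); first by ring.
  by field.
have K1 := derive1_affine_expR s _ _ _ _ K0.
have K2 := derive1_affine_expR s _ _ _ _ K1.
rewrite /K3 !derive1nS derive1n0 (derive1_affine_expR s _ _ _ _ K2 _ sx).
rewrite normE// /affexp [in RHS]mulrA; congr (_ * expR _); last by field.
rewrite /q; clearbody s.
have /orP[/eqP ->|/eqP ->] : (s == 1) || (s == - 1) by rewrite -sqrf_eq1 expr2 s2.
  by field.
by field.
Qed.
End kernels.

(** * Integrals of bounded functions against a finite measure *)

Section bounded_integrands.
Context d (T : measurableType d) (R : realType).
Variable mu : {finite_measure set T -> \bar R}.
Implicit Types (D : set T) (f g : T -> R).

Lemma bounded_integrable D f (B : R) : measurable D -> measurable_fun D f ->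
  (forall z, D z -> `|f z| <= B) -> mu.-integrable D (EFin \o f).
Proof.
move=> mD mf fB; apply: measurable_bounded_integrable => //.
  by rewrite ltey_eq fin_num_measure.
exists B; split; first exact: num_real.
by move=> r Br z Dz; exact: le_trans (fB z Dz) (ltW Br).
Qed.

Lemma norm_Rintegral_le D f (B : R) : measurable D -> measurable_fun D f ->
  0 <= B -> (forall z, D z -> `|f z| <= B) ->
  `|\int[mu]_(z in D) f z| <= B * fine (mu setT).
Proof.
move=> mD mf B0 fB; have fi := bounded_integrable D f B mD mf fB.
apply: le_trans (le_normr_Rintegral mD fi) _.
apply: (@le_trans _ _ (\int[mu]_(z in D) B)).
  apply: le_Rintegral => //.
    by apply: (bounded_integrable _ _ B) => //; [exact: measurableT_comp|
      move=> z /fB; rewrite normr_id].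
  by apply: (bounded_integrable _ _ `|B|).
rewrite Rintegral_cst// ler_wpM2l// fine_le ?fin_num_measure//.
by apply: le_measure; rewrite ?inE.
Qed.

End bounded_integrands.

(** * Interaction integrals and their dependence on the configuration *)

Section interaction.
Context {R : realType} (alpha : R) (alpha_gt0 : 0 < alpha).
Context (mu : {finite_measure set (measurableTypeR R) -> \bar R}).
Variables (a b : R) (D : set (measurableTypeR R)) (s : measurableTypeR R -> R).
Hypotheses (mD : measurable D) (ms : measurable_fun D s).
Hypothesis s1 : forall z, `|s z| <= 1.
Implicit Types w : measurableTypeR R -> R.

(** The weight [s] does not depend on [w]: it is 1 for H and the sign of [x - z] for the K'''
    integral. What depends on [w] is a Lipschitz function of distances. *)
Definition interaction w (x : R) : R :=
  \int[mu]_(z in D) (s z * affexp a b (`|w x - w z| / alpha)).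

Let dist_ge0 (y : R) : 0 <= `|y| / alpha.
Proof. by rewrite divr_ge0// ltW. Qed.

Let measurable_integrand w x : measurable_fun setT w ->
  measurable_fun D (fun z => s z * affexp a b (`|w x - w z| / alpha)).
Proof.
move=> mw; apply: measurable_funM => //.
apply: (measurable_funS measurableT) => //.
apply: (measurableT_comp (measurable_affexp a b)).
apply: measurable_funM => //; apply: measurableT_comp => //.
exact: measurable_funB.
Qed.

Let integrand_bounded w x z :
  `|s z * affexp a b (`|w x - w z| / alpha)| <= `|a| + `|b|.
Proof.
rewrite normrM (le_trans _ (affexp_bounded a b _ (dist_ge0 (w x - w z))))//.
by rewrite ler_piMl.
Qed.

Lemma interaction_bounded w x : measurable_fun setT w ->
  `|interaction w x| <= (`|a| + `|b|) * fine (mu setT).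
Proof.
by move=> mw; apply: norm_Rintegral_le => //; exact: measurable_integrand.
Qed.

(** Passing from [w] to [w'] moves both [w x] and [w z] by at most [e], so the scaled distance
    changes by at most 2e/alpha, while the common weight factors out. *)
Lemma interaction_lipschitz w w' x (e : R) :
  measurable_fun setT w -> measurable_fun setT w' ->
  (forall z, `|w z - w' z| <= e) ->
  `|interaction w x - interaction w' x| <=
  (`|a| + 2 * `|b|) * (2 / alpha) * fine (mu setT) * e.
Proof.
move=> mw mw' we.
have e0 : 0 <= e by apply: le_trans (we 0).
rewrite mulrAC -RintegralB//; first last.
- by apply: (bounded_integrable _ _ _ _ _ _ (`|a| + `|b|)) => //; exact: measurable_integrand.
- by apply: (bounded_integrable _ _ _ _ _ _ (`|a| + `|b|)) => //; exact: measurable_integrand.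
apply: norm_Rintegral_le => //.
- by apply: measurable_funB; exact: measurable_integrand.
- by rewrite !mulr_ge0// ?addr_ge0 ?mulr_ge0// invr_ge0 ltW.
move=> z _; rewrite -mulrBr normrM.
apply: (@le_trans _ _ (1 * ((`|a| + 2 * `|b|) *
    `| `|w x - w z| / alpha - `|w' x - w' z| / alpha|))).
  by apply: ler_pM => //; exact: affexp_lipschitz.
rewrite mul1r -mulrA ler_wpM2l ?addr_ge0 ?mulr_ge0//.
rewrite -mulrBl normrM normfV (gtr0_norm alpha_gt0) mulrAC ler_wpM2r//.
  by rewrite invr_ge0 ltW.
apply: le_trans (ler_dist_dist _ _) _.
have -> : w x - w z - (w' x - w' z) = (w x - w' x) - (w z - w' z) by ring.
by rewrite (le_trans (ler_normB _ _))//; have := we x; have := we z; lra.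
Qed.

End interaction.

(** * Boundedness and Lipschitz continuity of the velocity *)

Lemma measurable_sgr (R : realType) : measurable_fun setT (Num.sg : R -> R).
Proof.
apply: nondecreasing_measurable => // y z yz.
by case: (sgrP y) => ?; case: (sgrP z) => ?; lra.
Qed.

(** Combines estimates for the two factors of the velocity into one for their product, by
    telescoping. *)
Lemma sqr_mul_dist_le (R : realDomainType) (H H' J J' h j p q : R) :
  `|H| <= h -> `|H'| <= h -> `|J| <= j -> `|H - H'| <= p -> `|J - J'| <= q ->
  `|H ^+ 2 * J - H' ^+ 2 * J'| <= p * (2 * h) * j + h ^+ 2 * q.
Proof.
move=> Hh H'h Jj dH dJ.
have h0 : 0 <= h := le_trans (normr_ge0 _) Hh.
have -> : H ^+ 2 * J - H' ^+ 2 * J' =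
    (H - H') * (H + H') * J + H' ^+ 2 * (J - J') by ring.
apply: le_trans (ler_normD _ _) (lerD _ _).
  rewrite !normrM; apply: ler_pM => //; apply: ler_pM => //.
  by rewrite (le_trans (ler_normD _ _))//; lra.
rewrite normrM normrX; apply: ler_pM => //.
by rewrite lerXn2r ?nnegrE.
Qed.

Section velocity_estimates.
Context {R : realType} (alpha : R) (alpha_gt0 : 0 < alpha).
Context (mu : {finite_measure set (measurableTypeR R) -> \bar R}).
Implicit Types c : R -> R -> R.

(** [A], [A] are the coefficients of K as an [affexp]; [a], [b] are those of K''' up to sign. *)
Let A := (4 * alpha)^-1.
Let a := (2 * alpha ^+ 4)^-1.
Let b := - (4 * alpha ^+ 4)^-1.
Let D (x : R) : set (measurableTypeR R) := [set z | z != x].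
Let m := fine (mu setT).
Let m_ge0 : 0 <= m. Proof. exact: fine_ge0. Qed.

Let measurable_D x : measurable (D x).
Proof.
rewrite (_ : D x = ~` [set x]); first by apply: measurableC; exact: measurable_set1.
by apply/seteqP; split => z /= /eqP zx //; apply/eqP.
Qed.

Let measurable_sg x : measurable_fun (D x) (fun z => Num.sg (x - z)).
Proof.
apply: (measurableT_comp (measurable_sgr R)).
by apply: measurable_funB.
Qed.

Let sg_le1 x z : `|Num.sg (x - z)| <= 1 :> R.
Proof. by rewrite normr_sg; case: (_ != 0). Qed.

Lemma HfunE c x t :
  Hfun alpha mu c x t =
  interaction alpha mu A A setT (cst 1) (c ^~ t) x.
Proof. by apply: eq_Rintegral => z _; rewrite KfunE// mul1r. Qed.

(* Monotonicity of [c ^~ t] makes the sign of [c x t - c z t], where [K3]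
   jumps, independent of [c]. *)
Lemma velocityE c x t : class_I c -> 0 <= t ->
  velocity alpha mu c x t =
  Hfun alpha mu c x t ^+ 2 *
  interaction alpha mu a b (D x) (fun z => Num.sg (x - z)) (c ^~ t) x.
Proof.
move=> [_ _ _ c_incr] t0; congr (_ * _); apply: eq_Rintegral => z.
rewrite inE /D/= neq_lt => /orP[zx|xz].
  have cz := c_incr t t0 _ _ zx.
  by rewrite K3E// ?subr_eq0 ?gt_eqF// !gtr0_sg ?subr_gt0.
have cz := c_incr t t0 _ _ xz.
by rewrite K3E// ?subr_eq0 ?lt_eqF// !ltr0_sg ?subr_lt0.
Qed.

(** [h] and [j] bound H and the K''' integral; [h'] and [j'] are Lipschitz constants for them in the
    sup norm. *)
Let h := (`|A| + `|A|) * m.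
Let j := (`|a| + `|b|) * m.
Let h' := (`|A| + 2 * `|A|) * (2 / alpha) * m.
Let j' := (`|a| + 2 * `|b|) * (2 / alpha) * m.

Let h_ge0 : 0 <= h. Proof. by rewrite mulr_ge0 ?addr_ge0. Qed.
Let j_ge0 : 0 <= j. Proof. by rewrite mulr_ge0 ?addr_ge0. Qed.

Let H_le c x t : class_I c -> 0 <= t -> `|Hfun alpha mu c x t| <= h.
Proof.
move=> [_ mc _ _] t0; rewrite HfunE.
by apply: interaction_bounded => // [z|]; [rewrite normr1|exact: mc].
Qed.

Let J_le c x t : class_I c -> 0 <= t ->
  `|interaction alpha mu a b (D x) (fun z => Num.sg (x - z)) (c ^~ t) x| <= j.
Proof. by move=> [_ mc _ _] t0; apply: interaction_bounded => //; exact: mc. Qed.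

Lemma velocity_bounded : exists2 M : R, 0 < M &
  forall c x t, class_I c -> 0 <= t -> `|velocity alpha mu c x t| <= M.
Proof.
exists (h ^+ 2 * j + 1) => [|c x t Ic t0].
  by rewrite ltr_wpDl// mulr_ge0// sqr_ge0.
rewrite velocityE// normrM normrX; apply: (@le_trans _ _ (h ^+ 2 * j)); last by rewrite lerDl.
by apply: ler_pM; rewrite ?exprn_ge0// ?J_le// lerXn2r ?nnegrE// H_le.
Qed.

Lemma velocity_lipschitz : exists2 L : R, 0 < L &
  forall c c' x t e, class_I c -> class_I c' -> 0 <= t ->
    (forall z, `|c z t - c' z t| <= e) ->
    `|velocity alpha mu c x t - velocity alpha mu c' x t| <= L * e.
Proof.
have ai : 0 <= 2 / alpha by rewrite divr_ge0// ltW.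
have h'0 : 0 <= h'.
  by apply: mulr_ge0 => //; apply: mulr_ge0 => //; rewrite addr_ge0 ?mulr_ge0.
have j'0 : 0 <= j'.
  by apply: mulr_ge0 => //; apply: mulr_ge0 => //; rewrite addr_ge0 ?mulr_ge0.
have k1 : 0 <= h' * (2 * h) * j.
  by apply: mulr_ge0 => //; apply: mulr_ge0 => //; apply: mulr_ge0.
have k2 : 0 <= h ^+ 2 * j' by apply: mulr_ge0 => //; exact: exprn_ge0.
(* The summand 1 makes the constant positive, since the final argument divides by it. *)
exists (h' * (2 * h) * j + h ^+ 2 * j' + 1) => [|c c' x t e Ic Ic' t0 ce].
  by rewrite ltr_wpDl// addr_ge0.
have e0 : 0 <= e by apply: le_trans (ce 0).
have mc : measurable_fun setT ((c ^~ t) : measurableTypeR R -> R).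
  by case: Ic => _ + _ _; apply.
have mc' : measurable_fun setT ((c' ^~ t) : measurableTypeR R -> R).
  by case: Ic' => _ + _ _; apply.
rewrite !velocityE//.
have dH : `|Hfun alpha mu c x t - Hfun alpha mu c' x t| <= h' * e.
  by rewrite !HfunE; apply: interaction_lipschitz => // z; rewrite normr1.
have dJ := interaction_lipschitz alpha alpha_gt0 mu a b (D x) _ (measurable_D x)
  (measurable_sg x) (sg_le1 x) _ _ x e mc mc' ce.
apply: le_trans (sqr_mul_dist_le _ _ _ _ _ _ _ _ _ (H_le c x t Ic t0)
  (H_le c' x t Ic' t0) (J_le c x t Ic t0) dH dJ) _.
rewrite -/j'; clearbody h j h' j'.
have -> : h' * e * (2 * h) * j + h ^+ 2 * (j' * e) =
    (h' * (2 * h) * j + h ^+ 2 * j') * e by ring.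
by rewrite ler_wpM2r// lerDl.
Qed.

End velocity_estimates.

(** * Uniqueness by iterating the integral estimate *)

Lemma eq0_geometric_bound (R : realType) (x C : R) :
  (forall n, `|x| <= C * 2^-1 ^+ n) -> x = 0.
Proof.
move=> xC; apply/eqP; rewrite -normr_le0.
have /(cvg_geometric C) C0 : `|2^-1 : R| < 1 by rewrite ger0_norm; lra.
rewrite -(cvg_lim _ C0)//; apply: limr_ge; first by apply/cvg_ex; exists 0.
by near=> n; exact: xC.
Unshelve. all: by end_near. Qed.

Theorem theorem5p4 (R : realType) (alpha : R) (halpha : 0 < alpha)
    (mu : {finite_measure set (measurableTypeR R) -> \bar R})
    (mu_neq0 : ~ (forall A, measurable A -> mu A = 0%E))
    (mu_le1 : (tv_norm mu <= 1)%E)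
    (c c' : R -> R -> R) (hc : class_I c) (hc' : class_I c')
    (sol_c : solves_system alpha mu c) (sol_c' : solves_system alpha mu c') :
  forall x t : R, 0 <= t -> c x t = c' x t.
Proof.
have [M M0 vM] := velocity_bounded alpha halpha mu.
have [L L0 vL] := velocity_lipschitz alpha halpha mu.
(* The system only prescribes the value of a total derivative operator; that the derivative exists
   comes from [C1_nonneg]. *)
have sol_derive e x s : class_I e -> solves_system alpha mu e -> 0 < s ->
    is_derive (s : R) (1 : R) (e x) (velocity alpha mu e x s).
  move=> [_ _ eC1 _] [esol _] s0; apply: DeriveDef.
    exact: C1_nonneg_derivable.
  by rewrite -derive1E esol.
(* Both solutions start at [x], so their difference equals its own increment from time 0, to which
   [norm_increment_le] applies. *)
have estimate g dg x t : 0 <= t -> (forall s, is_derive (s : R) (1 : R) g (dg s)) ->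
    (forall s, 0 <= s ->
      `|velocity alpha mu c x s - velocity alpha mu c' x s| <= dg s) ->
    `|c x t - c' x t| <= g t - g 0.
  move=> t0 gd dgP; have [_ _ cC1 _] := hc; have [_ _ c'C1 _] := hc'.
  have [_ c0] := sol_c; have [_ c'0] := sol_c'.
  have -> : c x t - c' x t = (c x - c' x) t - (c x - c' x) 0.
    by rewrite !fctE c0 c'0; ring.
  apply: (@norm_increment_le R _
    (fun s => velocity alpha mu c x s - velocity alpha mu c' x s) _ dg) => //.
  - move=> s; rewrite in_itv/= => /andP[s0 _].
    by apply: is_deriveB; exact: sol_derive.
  - have cc : {within `[0, +oo[, continuous (c x - c' x)}.
      by apply: within_continuousB; exact: C1_nonneg_continuous.
    apply: continuous_subspaceW cc => s /=.
    by rewrite !in_itv/= andbT => /andP[].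
  - by move=> s; rewrite in_itv/= => /andP[/ltW s0 _]; exact: dgP.
have geom n : forall x t, 0 <= t ->
    `|c x t - c' x t| <= M / L * expR (2 * L * t) * 2^-1 ^+ n.
  elim: n => [x t t0|n IH x t t0].
    have := estimate (fun s => 2 * M * s) (fun=> 2 * M) x t t0.
    have gd (s : R) : is_derive s (1 : R) (fun s => 2 * M * s) (2 * M).
      by apply: is_derive_eq; rewrite /GRing.scale /=; ring.
    have dgP s : 0 <= s ->
        `|velocity alpha mu c x s - velocity alpha mu c' x s| <= 2 * M.
      move=> s0; rewrite mulr_natl mulr2n.
      by apply: le_trans (ler_normB _ _) (lerD _ _); exact: vM.
    move=> /(_ gd dgP)/le_trans; apply.
    rewrite expr0 mulr1 mulr0 subr0 (_ : 2 * M * t = M / L * (2 * L * t)).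
      rewrite ler_wpM2l ?divr_ge0 ?ltW//.
      by apply: lt_le_trans (expR_ge1Dx _); rewrite ltrDr.
    by field; rewrite gt_eqF.
  (* An antiderivative of L exp(2Ls) is exp(2Ls)/2, whence the extra factor 1/2; the contribution -q
     of the lower end point is discarded at the end. *)
  pose q := M / L * 2^-1 ^+ n.+1.
  have := estimate (fun s => q * expR (2 * L * s))
    (fun s => L * (M / L * expR (2 * L * s) * 2^-1 ^+ n)) x t t0.
  have gd (s : R) : is_derive s (1 : R) (fun s => q * expR (2 * L * s))
      (L * (M / L * expR (2 * L * s) * 2^-1 ^+ n)).
    apply: is_derive_eq; rewrite /GRing.scale /= /q exprS; field.
    by rewrite gt_eqF.
  (* The induction hypothesis is uniform in space, so at each time [s] it is the sup-norm bound that
     the Lipschitz estimate requires. *)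
  move=> /(_ gd)/(_ (fun s s0 => vL _ _ _ _ _ hc hc' s0 (IH ^~ s ^~ s0))).
  move/le_trans; apply.
  rewrite mulr0 expR0 mulr1 /q mulrAC lerBlDr lerDl.
  by rewrite mulr_ge0 ?divr_ge0 ?exprn_ge0 ?ltW// invr_gt0.
move=> x t t0; apply/eqP; rewrite -subr_eq0; apply/eqP.
by apply: eq0_geometric_bound => n; exact: geom.
Qed.
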